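(* Let $s\ge0$ and $a,b,l>0$. There exists $n_0$ such that for all $n\ge n_0$ the circle graph (cycle) on $n$ nodes does not form a Nash equilibrium when nodes transact with each other according to the Zipf distribution with parameter $s$.
   Context: A payment channel network is an undirected graph on a set $V$ of players (each channel = two opposite directed edges). All channels cost $l$ to a player: the channel cost of a player $u$ is $l$ times the number of channels incident to $u$. Zipf transaction distribution with parameter $s\ge 0$ (version averaged over ties): for a node $u$ in a graph on $V$, delete $u$ and its incident edges, obtaining a graph on $V'=V\setminus\{u\}$. Rank the nodes of $V'$ by (in-)degree (rank 1 = highest). For $v\in V'$ let $r_0(v)$ be the smallest rank of a node with the same degree as $v$, and $n(v)$ the number of nodes of $V'$ with that degree. Set $rf(v)=\frac{1}{n(v)}\sum_{j=r_0(v)}^{r_0(v)+n(v)-1}j^{-s}$ and $p^{trans}_{u,v}=rf(v)/\sum_{v'\in V'}rf(v')$, the probability that $u$ transacts with $v$. Expected revenue of $u$: $\mathbb{E}^{rev}_u=b\sum_{v_1\neq v_2,\ v_1,v_2\in V\setminus\{u\}}\frac{m_u(v_1,v_2)}{m(v_1,v_2)}p^{trans}_{v_1,v_2}$ (ordered pairs), where $m(v_1,v_2)$ is the number of shortest paths from $v_1$ to $v_2$, $m_u(v_1,v_2)$ the number of those passing through $u$ as an intermediary, and $b=N_{v_1}f_{avg}$ is assumed constant ($N_v$ = average number of transactions sent by $v$ per unit time, $f_{avg}$ = average fee). Expected fees of $u$: $\mathbb{E}^{fees}_u=a\sum_{v\neq u}d(u,v)\,p^{trans}_{u,v}$, where $a=N_uf^T_{avg}$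 ($f^T_{avg}$ = average fee paid to each intermediary) and $d(u,v)$ is the shortest path length, $+\infty$ if disconnected. Utility of $u$: $\mathbb{E}^{rev}_u-\mathbb{E}^{fees}_u-(\text{channel cost of }u)$, which is $-\infty$ for a disconnected node. All quantities (including $p^{trans}$) are computed in the current graph. A unilateral deviation of $u$ replaces the set of channels incident to $u$ by any other set of channels incident to $u$ (adding and/or removing channels), all other channels being unchanged. A graph is a Nash equilibrium if no player can strictly increase its utility by a unilateral deviation. *)

(* Defs.v *)
From mathcomp Require Import all_boot all_order all_algebra.
From mathcomp Require Import reals ereal exp.

Set Implicit Arguments.
Unset Strict Implicit.
Unset Printing Implicit Defensive.

Import Order.TTheory GRing.Theory Num.Theory.
Local Open Scope ring_scope.

Record network (V : finType) := Network {
  channel :> rel V;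
  channel_sym : symmetric channel;
  channel_irr : irreflexive channel }.

Section Graph.
Context {V : finType} (G : network V).

Definition degree (u : V) : nat := #|[set w | G u w]|.

(* The degree of v in the graph obtained from G by deleting the node u. *)
Definition degree_del (u v : V) : nat := #|[set w | (w != u) && G v w]|.

(* A path from x to y is represented by the sequence p of the nodes that follow
   x, so that its length is size p. *)
Definition path_between (x y : V) (p : seq V) : bool :=
  path G x p && (last x p == y).

(* Bounding lengths by #|V| loses nothing: if y is reachable from x, then every
   shortest path from x to y is free of repetitions. *)
Definition shortest_paths (x y : V) : {set #|V|.-bseq V} :=
  [set p : #|V|.-bseq V | path_between x y p &
     [forall q : #|V|.-bseq V, path_between x y q ==> (size p <= size q)%N]].

(* The nodes of the path x :: p other than its two endpoints. *)
Definition intermediaries (x : V) (p : seq V) : seq V := behead (belast x p).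

Definition num_shortest (x y : V) : nat := #|shortest_paths x y|.

Definition num_shortest_via (u x y : V) : nat :=
  #|[set p in shortest_paths x y | u \in intermediaries x p]|.

(* first_rank and num_same_degree do not depend on how ties are ordered here. *)
Definition ranking (u : V) : seq V :=
  sort (fun x y => degree_del u y <= degree_del u x)%N
       (enum [pred w | w != u]).

Definition first_rank (u v : V) : nat :=
  (find (fun w => degree_del u w == degree_del u v) (ranking u)).+1.

Definition num_same_degree (u v : V) : nat :=
  #|[set w | (w != u) && (degree_del u w == degree_del u v)]|.

End Graph.

Section Utility.
Context {R : realType} {V : finType} (G : network V).

Definition dist (x y : V) : \bar R :=
  if [pick p in shortest_paths G x y] is Some p then (size p)%:R%:E else +oo%E.

Definition rank_factor (s : R) (u v : V) : R :=
  (num_same_degree G u v)%:R^-1 *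
  \sum_(first_rank G u v <= j < first_rank G u v + num_same_degree G u v)
     j%:R `^ (- s).

Definition ptrans (s : R) (u v : V) : R :=
  rank_factor s u v / \sum_(w | w != u) rank_factor s u w.

(* A pair (x, y) without a connecting path contributes 0 / 0 = 0. *)
Definition revenue (s b : R) (u : V) : R :=
  b * \sum_(x | x != u) \sum_(y | (y != u) && (y != x))
        (num_shortest_via G u x y)%:R / (num_shortest G x y)%:R
          * ptrans s x y.

Definition fees (s a : R) (u : V) : \bar R :=
  (a%:E * \sum_(v | v != u) (dist u v * (ptrans s u v)%:E))%E.

Definition channel_cost (l : R) (u : V) : R := l * (degree G u)%:R.

Definition utility (s a b l : R) (u : V) : \bar R :=
  ((revenue s b u)%:E - fees s a u - (channel_cost l u)%:E)%E.

End Utility.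

(* H arises from G by replacing the set of channels incident to u. *)
Definition deviation {V : finType} (G : network V) (u : V) (H : network V) :=
  forall x y : V, x != u -> y != u -> H x y = G x y.

Definition nash_equilibrium {R : realType} {V : finType}
    (s a b l : R) (G : network V) : Prop :=
  forall (u : V) (H : network V), deviation G u H ->
    ~ (utility G s a b l u < utility H s a b l u)%E.

(* ordS is the cyclic successor on 'I_n; the condition i != j only matters when
   n = 1. *)
Definition cycle_rel (n : nat) : rel 'I_n :=
  fun i j => (i != j) && ((j == ordS i) || (i == ordS j)).

Lemma cycle_rel_sym (n : nat) : symmetric (@cycle_rel n).
Proof. by move=> i j; rewrite /cycle_rel eq_sym orbC. Qed.

Lemma cycle_rel_irr (n : nat) : irreflexive (@cycle_rel n).
Proof. by move=> i; rewrite /cycle_rel eqxx. Qed.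

Definition cycle_network (n : nat) : network 'I_n :=
  Network (@cycle_rel_sym n) (@cycle_rel_irr n).

(* Main.v *)
(* Let u = 0 add a channel to the antipodal node w = n/2.  The graph without u
   does not change, so neither do the probabilities with which u transacts, while
   its distance to the nodes near w drops by about n/4: the fees of u fall by an
   amount linear in n, which pays for one channel.  The revenue of u does not fall
   by more than a constant.  On the cycle, u carries at most the pairs x, y with
   2|x - y| >= n, each with probability at most 1/(n - 3), which gives
   b (n/4 + O(1)).  With the chord, a path that avoids u still has length at least
   |x - y|, so u keeps all pairs with 2|x - y| > n.  For x not close to u or w, the
   nodes u and w now share the two top ranks, so x sends equal fractions P of its
   transactions to each of them and a fraction r to every node of degree 2, where
   2P + n r >= 1 - O(1/n).  About n/2 nodes x reach w most cheaply through u, so the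
   revenue is at least b (n/2 P + n^2/4 r - O(1)) = b (n/4 - O(1)). *)

Require Import Defs.
From mathcomp Require Import all_boot all_order all_algebra.
From mathcomp Require Import reals ereal exp.
From mathcomp Require Import zify ring lra.

Set Implicit Arguments.
Unset Strict Implicit.
Unset Printing Implicit Defensive.

Import Order.TTheory GRing.Theory Num.Theory.
Local Open Scope ring_scope.

(** * Ranks and transaction probabilities *)

(** The entries above [d] come first, directly followed by those equal to [d]. This makes
    [first_rank] a cardinality, independent of how [sort] orders ties. *)
Lemma find_sorted_decreasing (T : eqType) (f : T -> nat) (d : nat) (t : seq T) :
  sorted (fun x y => f y <= f x)%N t -> has (fun w => f w == d) t ->
  find (fun w => f w == d) t = count (fun w => d < f w)%N t.
Proof.
elim: t => [//|x t IHt] /= xt.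
have tr : transitive (fun x y => f y <= f x)%N by move=> y z v /[swap]; apply: leq_trans.
have := path_sortedE tr x t; rewrite xt => /esym/andP[/allP xge t_sorted].
case: (eqVneq (f x) d) => [fxd _|fxd /= hd].
  rewrite -fxd ltnn add0n; apply/esym/eqP; rewrite -leqn0 leqNgt -has_count.
  by apply/hasPn => y yt; rewrite -leqNgt xge.
rewrite IHt // -add1n; congr (_ + _)%N.
have /hasP[y yt /eqP fy] := hd.
by have := xge _ yt; rewrite fy leq_eqVlt eq_sym (negPf fxd) /= => ->.
Qed.

Lemma powRN_anti (R : realType) (s : R) (i j : nat) :
  0 <= s -> (0 < i)%N -> (i <= j)%N -> j%:R `^ (- s) <= i%:R `^ (- s).
Proof.
move=> s_ge0 i0 ij; rewrite !powRN lef_pV2 ?posrE ?powR_gt0 ?ltr0n //; last by lia.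
by rewrite ge0_ler_powR ?nnegrE ?ler0n ?ler_nat.
Qed.

(** The rank factor shared by [m] tied nodes that occupy the ranks from [k] to [k + m - 1]. *)
Definition average_rank_weight (R : realType) (s : R) (k m : nat) : R :=
  m%:R^-1 * \sum_(k <= j < k + m) j%:R `^ (- s).

Section AverageRankWeight.
Context {R : realType} (s : R) (k m : nat).
Hypotheses (k_gt0 : (0 < k)%N) (m_gt0 : (0 < m)%N).

Lemma average_rank_weight_gt0 : 0 < average_rank_weight s k m.
Proof.
rewrite mulr_gt0 ?invr_gt0 ?ltr0n //.
rewrite big_ltn -?ltn_subLR ?subnn // ltr_pwDl ?sumr_ge0 //.
by rewrite powR_gt0 // ltr0n.
Qed.

Hypothesis s_ge0 : 0 <= s.

Lemma average_rank_weight_le : average_rank_weight s k m <= k%:R `^ (- s).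
Proof.
rewrite ler_pdivrMl ?ltr0n // -[X in X%:R * _](addKn k) mulrC mulr_natr.
rewrite -sumr_const_nat; apply: ler_sum_nat => j /andP[jl _].
exact: powRN_anti.
Qed.

Lemma average_rank_weight_ge : (k + m)%:R `^ (- s) <= average_rank_weight s k m.
Proof.
rewrite ler_pdivlMl ?ltr0n // -[X in X%:R * _](addKn k) mulrC mulr_natr.
rewrite -sumr_const_nat; apply: ler_sum_nat => j /andP[jl jr].
by apply: powRN_anti; lia.
Qed.

End AverageRankWeight.

Section Ranks.
Context {R : realType} {V : finType} (G : network V) (s : R).

Lemma first_rankE u v : v != u ->
  first_rank G u v =
  #|[set w | (w != u) && (degree_del G u v < degree_del G u w)%N]|.+1.
Proof.
move=> vu; congr _.+1; rewrite find_sorted_decreasing.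
- rewrite (permP (permEl (perm_sort _ _))) cardE -size_filter.
  rewrite /enum_mem -filter_predI.
  by congr size; apply: eq_filter => w; rewrite /= !inE andbC.
- by apply: sort_sorted => x y; apply: leq_total.
- apply/hasP; exists v => //.
  by rewrite mem_sort mem_enum.
Qed.

Lemma num_same_degree_gt0 u v : v != u -> (0 < num_same_degree G u v)%N.
Proof. by move=> vu; apply/card_gt0P; exists v; rewrite inE vu eqxx. Qed.

Lemma rank_factor_eq u v v' : v != u -> v' != u ->
  degree_del G u v = degree_del G u v' ->
  rank_factor G s u v = rank_factor G s u v'.
Proof.
move=> vu v'u e.
by rewrite /rank_factor /num_same_degree !first_rankE // e.
Qed.

Lemma rank_factorE u v :
  rank_factor G s u v =
  average_rank_weight s (first_rank G u v) (num_same_degree G u v).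
Proof. by []. Qed.

Lemma rank_factor_gt0 u v : v != u -> 0 < rank_factor G s u v.
Proof.
by move=> vu; rewrite average_rank_weight_gt0 ?num_same_degree_gt0 ?first_rankE.
Qed.

Hypothesis s_ge0 : 0 <= s.

(** Nodes ranked ahead of [v'] or tied with it are all ahead of [v], so the ranks of the class of
    [v'] end before those of [v] begin. A value of [j^(-s)] at the boundary separates the two
    averages. *)
Lemma rank_factor_mono u v v' : v != u -> v' != u ->
  (degree_del G u v <= degree_del G u v')%N ->
  rank_factor G s u v <= rank_factor G s u v'.
Proof.
move=> vu v'u; rewrite leq_eqVlt => /orP[/eqP e|lt]; first by rewrite (rank_factor_eq _ _ e).
have n0 := num_same_degree_gt0 vu; have n0' := num_same_degree_gt0 v'u.
apply: le_trans (average_rank_weight_le _ n0 s_ge0) _; first by rewrite first_rankE.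
apply: le_trans (average_rank_weight_ge _ n0' s_ge0); last by rewrite first_rankE.
apply: powRN_anti => //.
rewrite !first_rankE // addSn ltnS /num_same_degree.
rewrite -cardsUI [X in (_ + X)%N](_ : _ = 0)%N ?addn0.
  apply: subset_leq_card; apply/subsetP => w; rewrite !inE => /orP[] /andP[-> ] /=.
    exact: ltn_trans.
  by move/eqP=> ->.
apply/eqP; rewrite cards_eq0; apply/eqP/setP => w; rewrite !inE.
by apply/negP => /andP[/andP[_ h] /andP[_ /eqP e]]; rewrite e ltnn in h.
Qed.

Lemma rank_factor_sum_gt0 u v : v != u -> 0 < \sum_(w | w != u) rank_factor G s u w.
Proof.
move=> vu; rewrite (bigD1 v) //= ltr_pwDl ?rank_factor_gt0 ?sumr_ge0 // => w /andP[wu _].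
by rewrite ltW ?rank_factor_gt0.
Qed.

Lemma ptrans_ge0 u v : v != u -> 0 <= ptrans G s u v.
Proof. by move=> vu; rewrite divr_ge0 // ltW ?(rank_factor_sum_gt0 vu) ?rank_factor_gt0. Qed.

Lemma ptrans_sum u v : v != u -> \sum_(w | w != u) ptrans G s u w = 1.
Proof. by move=> vu; rewrite -mulr_suml divff // gt_eqF ?(rank_factor_sum_gt0 vu). Qed.

Lemma ptrans_eq u v v' : v != u -> v' != u ->
  degree_del G u v = degree_del G u v' -> ptrans G s u v = ptrans G s u v'.
Proof. by move=> vu v'u e; rewrite /ptrans (rank_factor_eq vu v'u e). Qed.

Lemma ptrans_mono u v v' : v != u -> v' != u ->
  (degree_del G u v <= degree_del G u v')%N -> ptrans G s u v <= ptrans G s u v'.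
Proof.
move=> vu v'u e; rewrite ler_pM2r ?rank_factor_mono //.
by rewrite invr_gt0 (rank_factor_sum_gt0 vu).
Qed.

(** Tied nodes have equal probabilities, and these sum to at most 1. *)
Lemma ptrans_le_num_same_degree u v : v != u ->
  ptrans G s u v <= (num_same_degree G u v)%:R^-1.
Proof.
move=> vu; have n0 := num_same_degree_gt0 vu.
rewrite -[leRHS]mul1r ler_pdivlMr ?ltr0n // mulr_natr.
rewrite /num_same_degree -sumr_const -(ptrans_sum vu) big_mkcond [leRHS]big_mkcond.
apply: ler_sum => w _; rewrite inE.
case: (eqVneq w u) => //= wu; case: eqVneq => [e|_]; last exact: ptrans_ge0.
by rewrite (ptrans_eq _ _ e).
Qed.

End Ranks.

(** The ranking seen by [u] is computed after deleting [u], hence from channels that the deviation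
    leaves unchanged. *)
Lemma ptrans_deviation (R : realType) (V : finType) (G H : network V) (s : R) (u v : V) :
  deviation G u H -> v != u -> ptrans H s u v = ptrans G s u v.
Proof.
move=> dev.
have deg w : w != u -> degree_del H u w = degree_del G u w.
  move=> wu; congr (#|pred_of_set _|); apply/setP => x; rewrite !inE.
  by case: (eqVneq x u) => //= xu; rewrite dev.
have rf w : w != u -> rank_factor H s u w = rank_factor G s u w.
  move=> wu; rewrite /rank_factor !first_rankE // /num_same_degree deg //.
  have -> : [set x | (x != u) && (degree_del H u x == degree_del G u w)] =
            [set x | (x != u) && (degree_del G u x == degree_del G u w)].
    by apply/setP => x; rewrite !inE; case: (eqVneq x u) => //= xu; rewrite deg.
  have -> // : [set x | (x != u) && (degree_del G u w < degree_del H u x)%N] =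
            [set x | (x != u) && (degree_del G u w < degree_del G u x)%N].
  by apply/setP => x; rewrite !inE; case: (eqVneq x u) => //= xu; rewrite deg.
by move=> vu; rewrite /ptrans rf //; congr (_ / _); apply: eq_bigr.
Qed.

(** * Walks and shortest paths *)

(** Lengths are not bounded by [#|V|] here, so walks can be concatenated freely. *)
Definition walk (V : finType) (G : network V) (k : nat) (x y : V) : Prop :=
  exists2 p, path_between G x y p & size p = k.

Section Walks.
Context {V : finType} (G : network V).

Lemma walk0 x : walk G 0 x x.
Proof. by exists [::]; rewrite /path_between /= ?eqxx. Qed.

Lemma walk1 x y : G x y -> walk G 1 x y.
Proof. by move=> xy; exists [:: y]; rewrite /path_between /= ?xy ?eqxx. Qed.

Lemma walk_cat j k x y z : walk G j x y -> walk G k y z -> walk G (j + k) x z.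
Proof.
move=> [p /andP[px /eqP py] <-] [q /andP[qy /eqP qz] <-].
by exists (p ++ q); rewrite ?size_cat // /path_between cat_path last_cat px py qy qz /=.
Qed.

Lemma walk_sym k x y : walk G k x y -> walk G k y x.
Proof.
move=> [p]; elim: p x k => [|a p IHp] x k; rewrite /path_between /=.
  by move=> /eqP -> <-; exact: walk0.
move=> /andP[/andP[xa ap] py] <-; rewrite -addn1.
apply: (walk_cat (IHp a (size p) _ erefl)); first by rewrite /path_between ap.
by apply: walk1; rewrite channel_sym.
Qed.

(** Cutting the loops out of a walk makes it short enough to compete in the bounded minimum that
    defines [shortest_paths]. *)
Lemma shortest_paths_min x y (p : #|V|.-bseq V) k :
  p \in shortest_paths G x y -> walk G k x y -> (size p <= k)%N.
Proof.
rewrite inE => /andP[_ /forallP pmin] [q /andP[qx /eqP qy] <-].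
move: qy; case/shortenP: qx => q' q'x uq' sub q'y.
have sq' : (size q' <= #|V|)%N.
  by have := card_uniqP uq' => /= e; have := max_card (mem (x :: q')); rewrite e => /ltnW.
have /implyP := pmin (Bseq sq'); rewrite /path_between q'x q'y eqxx => /(_ isT) /leq_trans.
apply; apply: uniq_leq_size sub; by case/andP: uq'.
Qed.

Lemma path_between_shortest x y (p : #|V|.-bseq V) :
  p \in shortest_paths G x y -> path_between G x y p.
Proof. by rewrite inE => /andP[]. Qed.

Lemma shortest_paths_ex k x y : walk G k x y ->
  exists p : #|V|.-bseq V, p \in shortest_paths G x y.
Proof.
move=> [q /andP[qx /eqP qy] _]; move: qy; case/shortenP: qx => q' q'x uq' _ q'y.
have sq' : (size q' <= #|V|)%N.
  by have := card_uniqP uq' => /= e; have := max_card (mem (x :: q')); rewrite e => /ltnW.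
have Pq' : path_between G x y (Bseq sq') by rewrite /path_between q'x q'y eqxx.
pose p := [arg min_(p < Bseq sq' | path_between G x y (p : #|V|.-bseq V)) size p].
exists p; rewrite /p; case: arg_minnP => // {}p pP pmin.
by rewrite inE pP; apply/forallP => r; apply/implyP; exact: pmin.
Qed.

Lemma dist_walk (R : realType) k x y : walk G k x y ->
  exists d : nat, [/\ @dist R V G x y = d%:R%:E, walk G d x y &
    forall j, walk G j x y -> (d <= j)%N].
Proof.
move=> xy; rewrite /dist; case: pickP => [p ps|none].
  exists (size p); split=> //; first by exists p => //; exact: path_between_shortest.
  by move=> j; exact: shortest_paths_min.
by have [p] := shortest_paths_ex xy; rewrite none.
Qed.

Lemma fees_connected (R : realType) (s a : R) u : (forall v, exists k, walk G k u v) ->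
  fees G s a u = (a * \sum_(v | v != u) fine (dist G u v) * ptrans G s u v)%:E.
Proof.
move=> conn; rewrite /fees EFinM -sumEFin; congr (_ * _)%E; apply: eq_bigr => v _.
by have [k /(dist_walk R)[d [-> _ _]]] := conn v.
Qed.

Lemma mem_intermediaries u x y p : y != u -> path_between G x y p ->
  (u \in intermediaries x p) = (u \in p).
Proof.
case: p => [//|a p] yu /andP[_ /= /eqP ly].
by rewrite /intermediaries /= lastI mem_rcons ly inE eq_sym (negPf yu).
Qed.

Lemma num_shortest_via_le u x y :
  (num_shortest_via G u x y <= num_shortest G x y)%N.
Proof. by apply: subset_leq_card; apply/subsetP => p; rewrite inE => /andP[]. Qed.

Lemma num_shortest_ratio_le1 (R : realType) u x y :
  (num_shortest_via G u x y)%:R / (num_shortest G x y)%:R <= 1 :> R.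
Proof.
case: (posnP (num_shortest G x y)) => [->|pos]; first by rewrite invr0 mulr0 ler01.
by rewrite ler_pdivrMr ?ltr0n // mul1r ler_nat num_shortest_via_le.
Qed.

Lemma num_shortest_via_eq0 k u x y : y != u -> walk G k x y ->
  (forall p, path_between G x y p -> u \in p -> (k < size p)%N) ->
  num_shortest_via G u x y = 0%N.
Proof.
move=> yu xy long; apply/eqP; rewrite cards_eq0; apply/eqP/setP => p.
rewrite in_set0 in_set; apply/negP => /andP[ps].
rewrite (mem_intermediaries yu (path_between_shortest ps)).
move=> /(long _ (path_between_shortest ps)).
by rewrite ltnNge (shortest_paths_min ps xy).
Qed.

(** Positivity is part of the conclusion so that the quotient of the two numbers is 1 and not 0 / 0
    = 0. *)
Lemma num_shortest_via_all k u x y : y != u -> walk G k x y ->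
  (forall p, path_between G x y p -> u \notin p -> (k < size p)%N) ->
  num_shortest_via G u x y = num_shortest G x y /\ (0 < num_shortest G x y)%N.
Proof.
move=> yu xy long; split; last first.
  by have [p ps] := shortest_paths_ex xy; apply/card_gt0P; exists p.
congr (#|pred_of_set _|); apply/setP => p; rewrite in_set.
case ps: (p \in _) => //=; rewrite (mem_intermediaries yu (path_between_shortest ps)).
apply: contraT => /(long _ (path_between_shortest ps)).
by rewrite ltnNge (shortest_paths_min ps xy).
Qed.

End Walks.

Lemma walk_mono (V : finType) (G H : network V) k x y :
  subrel G H -> walk G k x y -> walk H k x y.
Proof.
move=> GH [p /andP[px py] <-]; exists p => //.
by rewrite /path_between py (sub_path GH).
Qed.

(** The source of all lower bounds on path lengths: a potential that changes by at most 1 along each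
    edge. *)
Lemma path_lipschitz (V : eqType) (e : rel V) (f : V -> nat) x p :
  (forall y z, e y z -> (f y <= (f z).+1)%N && (f z <= (f y).+1)%N) ->
  path e x p ->
  (f x <= f (last x p) + size p)%N && (f (last x p) <= f x + size p)%N.
Proof.
move=> lip; elim: p x => [|a p IHp] x /=; first by rewrite addn0 leqnn.
by move=> /andP[/lip xa /IHp]; lia.
Qed.

(** * Adding a channel *)

Section Degrees.
Context {V : finType} (G : network V).

Lemma degree_delE u v : (degree_del G u v + G v u)%N = degree G v.
Proof.
rewrite /degree (cardsD1 u) inE addnC; congr (_ + #|pred_of_set _|)%N.
by apply/setP => w; rewrite !inE.
Qed.

Context (u w : V) (neq_uw : u != w).

Definition add_channel_rel : rel V :=
  fun x y => [|| G x y, (x == u) && (y == w) | (x == w) && (y == u)].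

Lemma add_channel_sym : symmetric add_channel_rel.
Proof.
move=> x y; rewrite /add_channel_rel channel_sym; congr (_ || _).
by rewrite orbC andbC [X in _ || X]andbC.
Qed.

Lemma add_channel_irr : irreflexive add_channel_rel.
Proof.
move=> x; rewrite /add_channel_rel channel_irr /=; apply/negP.
by case/orP => /andP[/eqP -> /eqP e]; move: neq_uw; rewrite e eqxx.
Qed.

Definition add_channel : network V := Network add_channel_sym add_channel_irr.

Lemma add_channel_deviation : deviation G u add_channel.
Proof.
by move=> x y /negPf xu /negPf yu; rewrite /= /add_channel_rel xu yu andbF !orbF.
Qed.

Lemma add_channel_sub : subrel G add_channel.
Proof. by move=> x y xy; rewrite /= /add_channel_rel xy. Qed.

Lemma add_channel_new : add_channel u w.
Proof. by rewrite /= /add_channel_rel !eqxx orbT. Qed.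

Lemma add_channel_old v x : x != u -> x != w -> add_channel v x = G v x.
Proof. by move=> /negPf xu /negPf xw; rewrite /= /add_channel_rel xu xw !andbF !orbF. Qed.

Lemma degree_add_channel v : ~~ G u w ->
  degree add_channel v = (degree G v + (v \in [set u; w]))%N.
Proof.
move=> Guw; rewrite !inE /degree; case: (eqVneq v u) => [->|vu] /=.
  rewrite (_ : [set _ | _] = w |: [set x | G u x]) ?cardsU1 ?inE ?Guw 1?addnC //.
  apply/setP => x; rewrite !inE /add_channel_rel eqxx (negPf neq_uw) /= orbF.
  by rewrite orbC.
case: (eqVneq v w) => [->|vw] /=.
  rewrite (_ : [set _ | _] = u |: [set x | G w x]) ?cardsU1 ?inE 1?channel_sym ?Guw 1?addnC //.
  apply/setP => x; rewrite !inE /add_channel_rel eqxx eq_sym (negPf neq_uw) /=.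
  by rewrite orbC.
rewrite addn0; congr #|pred_of_set _|; apply/setP => x.
by rewrite !inE /add_channel_rel (negPf vu) (negPf vw) !orbF.
Qed.

End Degrees.

(** * Transaction probabilities with three degree classes *)

Section ThreeClasses.
Context {R : realType} {V : finType} (G : network V) (s : R).
Context (x : V) (A B : {set V}).
Hypotheses (xA : x \notin A) (xB : x \notin B) (AB : [disjoint A & B]).
Hypotheses (cardA : #|A| = 2%N) (cardB : #|B| = 2%N) (cardV : (5 < #|V|)%N).
(* The nodes of A have degree 3, those of B degree 1, all others degree 2. *)
Hypothesis degE : forall v, v != x ->
  (degree_del G x v + (v \in B) = 2 + (v \in A))%N.

Let F (k m : nat) := average_rank_weight s k m.
Let n := #|V|.

Let card_xAB : #|x |: (A :|: B)| = 5%N.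
Proof.
rewrite cardsU1 !inE negb_or xA xB cardsU cardA cardB.
by move: AB; rewrite -setI_eq0 => /eqP ->; rewrite cards0.
Qed.

Let BnA v : v \in B -> (v \in A) = false.
Proof. exact: disjointFl. Qed.

Let nx v : (v \in A) || (v \in B) -> v != x.
Proof. by case/orP => h; apply: contraTneq h => ->. Qed.

Let cardC : #|~: (x |: (A :|: B))| = (n - 5)%N.
Proof. by have := cardsC (x |: (A :|: B)); rewrite card_xAB /n; lia. Qed.

Let rank_factor_card v m k : v != x ->
  #|[set w | (w != x) && (degree_del G x w == degree_del G x v)]| = m ->
  #|[set w | (w != x) && (degree_del G x v < degree_del G x w)%N]| = k ->
  rank_factor G s x v = F k.+1 m.
Proof. by move=> vx <- <-; rewrite rank_factorE first_rankE. Qed.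

Let rfA v : v \in A -> rank_factor G s x v = F 1 2.
Proof.
move=> vA; have vx : v != x by rewrite nx ?vA.
have vB := disjointFr AB vA.
have dv := degE vx; rewrite vA vB /= in dv.
apply: rank_factor_card => //.
  rewrite -cardA; congr #|pred_of_set _|; apply/setP => y; rewrite inE.
  case: (eqVneq y x) => [->|yx] /=; first by rewrite (negPf xA).
  have := degE yx; have := @BnA y; case: (y \in B) (y \in A) => [] [] H;
    by [have := H isT | move: dv; clear=> /= *; lia].
apply/eqP; rewrite cards_eq0; apply/eqP/setP => y; rewrite !inE.
case: (eqVneq y x) => //= yx; have := degE yx.
by case: (y \in B) (y \in A) => [] []; move: dv; clear=> /= *; lia.
Qed.

Let rfB v : v \in B -> rank_factor G s x v = F (n - 2) 2.
Proof.
move=> vB; have vx : v != x by rewrite nx ?vB ?orbT.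
have vA := BnA vB.
have dv := degE vx; rewrite vA vB /= in dv.
rewrite (_ : n - 2 = (n - 3).+1)%N; last by rewrite /n; lia.
apply: rank_factor_card => //.
  rewrite -cardB; congr #|pred_of_set _|; apply/setP => y; rewrite inE.
  case: (eqVneq y x) => [->|yx] /=; first by rewrite (negPf xB).
  have := degE yx; have := @BnA y; case: (y \in B) (y \in A) => [] [] H;
    by [have := H isT | move: dv; clear=> /= *; lia].
have <- : #|~: (x |: B)| = (n - 3)%N.
  by have := cardsC (x |: B); rewrite cardsU1 xB cardB /n; lia.
congr #|pred_of_set _|; apply/setP => y; rewrite !inE.
case: (eqVneq y x) => //= yx; have := degE yx; have := @BnA y.
case: (y \in B) (y \in A) => [] [] H;
    by [have := H isT | move: dv; clear=> /= *; lia].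
Qed.

Let rfC v : v != x -> v \notin A -> v \notin B -> rank_factor G s x v = F 3 (n - 5).
Proof.
move=> vx /negPf vA /negPf vB.
have dv := degE vx; rewrite vA vB /= in dv.
apply: rank_factor_card => //.
  rewrite -cardC; congr #|pred_of_set _|; apply/setP => y; rewrite !inE.
  case: (eqVneq y x) => //= yx; have := degE yx; have := @BnA y.
  case: (y \in B) (y \in A) => [] [] H;
    by [have := H isT | move: dv; clear=> /= *; lia].
rewrite -cardA; congr #|pred_of_set _|; apply/setP => y; rewrite inE.
case: (eqVneq y x) => [->|yx] /=; first by rewrite (negPf xA).
have := degE yx; have := @BnA y; case: (y \in B) (y \in A) => [] [] H;
    by [have := H isT | move: dv; clear=> /= *; lia].
Qed.

Let Z := \sum_(v | v != x) rank_factor G s x v.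

Let ZE : Z = 2 * F 1 2 + (n - 5)%:R * F 3 (n - 5) + 2 * F (n - 2) 2.
Proof.
have cst (S : {set V}) m (c : R) : #|S| = m -> m%:R * c = \sum_(v in S) c.
  by move=> <-; rewrite sumr_const mulr_natl.
rewrite (cst _ _ _ cardA) (cst _ _ _ cardC) (cst _ _ _ cardB).
rewrite /Z big_mkcond [\sum_(v in A) _]big_mkcond [\sum_(v in ~: _) _]big_mkcond.
rewrite [\sum_(v in B) _]big_mkcond -!big_split /=; apply: eq_bigr => v _; rewrite !inE.
case: (eqVneq v x) => [->|vx] /=; first by rewrite (negPf xA) (negPf xB) !addr0.
case vA: (v \in A) => /=; first by rewrite rfA // (disjointFr AB vA) /= !addr0.
case vB: (v \in B) => /=; first by rewrite rfB // !add0r.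
by rewrite rfC ?vA ?vB // add0r addr0.
Qed.

(** The class [A] takes the ranks 1 and 2, the middle class 3 to [n - 3], and [B] the last two,
    [n - 2] and [n - 1]. In the application [A] consists of the ends of the chord and [B] of the
    neighbours of [x]. *)
Lemma ptrans_three_classes v : v != x ->
  ptrans G s x v =
  (if v \in A then average_rank_weight s 1 2
   else if v \in B then average_rank_weight s (#|V| - 2) 2
   else average_rank_weight s 3 (#|V| - 5)) /
  (2 * average_rank_weight s 1 2 +
   (#|V| - 5)%:R * average_rank_weight s 3 (#|V| - 5) +
   2 * average_rank_weight s (#|V| - 2) 2).
Proof.
move=> vx; rewrite /ptrans -[X in _ / X]/Z ZE; congr (_ / _).
case: ifPn => vA; first exact: rfA.
case: ifPn => vB; first exact: rfB.
exact: rfC.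
Qed.

End ThreeClasses.

(** * The cycle *)

(** Subtraction is truncated, so one summand vanishes and this is [|x - y|]. *)
Definition gap (x y : nat) : nat := (x - y + (y - x))%N.

(** The two summands count the [y >= x + h] and the [y <= x - h]. *)
Lemma sum_gap_ge (h n x : nat) : (0 < h)%N ->
  (\sum_(0 <= y < n) (h <= gap x y) = (n - (x + h)) + minn n (x.+1 - h))%N.
Proof.
rewrite /gap => h0; elim: n => [|n IHn]; first by rewrite big_geq // min0n.
by rewrite big_nat_recr //= IHn; lia.
Qed.

Lemma sum_gap_ge2 (h n : nat) : (0 < h)%N ->
  (\sum_(x < n) \sum_(y < n) (h <= gap x y) = (n - h) * (n - h).+1)%N.
Proof.
move=> h0.
have tri m : (2 * (\sum_(0 <= x < m) (x.+1 - h)) = (m - h) * (m - h).+1)%N.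
  elim: m => [|m IHm]; first by rewrite big_geq // muln0.
  rewrite big_nat_recr //= mulnDr IHm.
  case: (leqP h m) => hm; first by rewrite subSn //; nia.
  by have [-> ->] : (m - h = 0 /\ m.+1 - h = 0)%N by lia.
(* Reversing the order of the indices exchanges the pairs with [y] below [x] and those with [y]
   above, so both halves are the same triangular number. *)
have rev : (\sum_(x < n) (x.+1 - h) = \sum_(x < n) (n - (x + h)))%N.
  rewrite (reindex_inj rev_ord_inj); apply: eq_bigr => x _ /=.
  by have := ltn_ord x; lia.
rewrite -tri mul2n -addnn big_mkord {1}rev -big_split /=; apply: eq_bigr => x _.
rewrite -(big_mkord xpredT (fun y => (h <= gap x y) : nat)) sum_gap_ge //.
by have := ltn_ord x; lia.
Qed.

Lemma sum_lt_ge (n a c : nat) :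
  (\sum_(0 <= x < n) ((x < a) + (c <= x)) = minn n a + (n - c))%N.
Proof.
elim: n => [|n IHn]; first by rewrite big_geq // min0n.
by rewrite big_nat_recr //= IHn; lia.
Qed.

Lemma sum_interval (n a c : nat) :
  (\sum_(0 <= x < n) (a <= x < c) = minn n c - a)%N.
Proof.
elim: n => [|n IHn]; first by rewrite big_geq // min0n.
by rewrite big_nat_recr //= IHn; lia.
Qed.

Section Cycle.
Context (n : nat).
Hypothesis n_ge3 : (2 < n)%N.
Notation G := (cycle_network n).
Implicit Types i j : 'I_n.

(** Adjacency as arithmetic on indices, which [lia] can decide. *)
Lemma cycleE i j : G i j =
  [|| j == i.+1 :> nat, i == j.+1 :> nat, (i == 0 :> nat) && (j == n.-1 :> nat)
    | (j == 0 :> nat) && (i == n.-1 :> nat)].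
Proof.
have ordSE (k k' : 'I_n) : (k' == ordS k) =
    (k' == k.+1 :> nat) || ((k' == 0 :> nat) && (k == n.-1 :> nat)).
  rewrite -val_eqE /=; have := ltn_ord k; rewrite leq_eqVlt => /orP[/eqP e|lt].
    rewrite e modnn; have := ltn_ord k'; lia.
  rewrite modn_small //; lia.
rewrite /= /cycle_rel !ordSE -val_eqE /=; lia.
Qed.

Lemma degree_cycle i : degree G i = 2%N.
Proof.
have pS j : (i == ordS j) = (j == ord_pred i).
  by apply/eqP/eqP => [->|->]; rewrite ?ordSK ?ord_predK.
have valS (j : 'I_n) : val (ordS j) = if j.+1 == n then 0%N else j.+1.
  rewrite /=; case: eqP => [->|jn]; first by rewrite modnn.
  by rewrite modn_small //; have := ltn_ord j; lia.
have iS := valS i; have iP := valS (ord_pred i); rewrite ord_predK in iP.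
have Si : ordS i != i by rewrite -val_eqE iS; case: ifP => /=; lia.
have Pi : ord_pred i != i by rewrite -val_eqE; move: iP => /=; case: ifP => /=; lia.
have SP : ordS i != ord_pred i.
  by rewrite -val_eqE iS; move: iP => /=; do 2 case: ifP => /=; lia.
rewrite /degree (_ : [set _ | _] = [set ordS i; ord_pred i]) ?cards2 ?SP //.
apply/setP => j; rewrite !inE /= /cycle_rel pS.
by case: (eqVneq i j) => [<-|] //=; rewrite eq_sym (negPf Si) eq_sym (negPf Pi).
Qed.

Lemma degree_del_cycle i j : degree_del G i j = (2 - G i j)%N.
Proof. by have := degree_delE G i j; rewrite degree_cycle channel_sym; lia. Qed.

Lemma cycle_walk_up i j : (i <= j)%N -> walk G (j - i) i j.
Proof.
case: j => j jn /= ij; rewrite -(subnKC ij) in jn *.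
elim: (j - i)%N jn => [|k IHk] kn.
  have -> : Ordinal kn = i by apply: val_inj; rewrite /= addn0.
  by rewrite addn0 subnn; exact: walk0.
have kn' : (i + k < n)%N by lia.
rewrite addKn -[X in walk _ X]addn1; apply: (walk_cat (y := Ordinal kn') _ (walk1 _)).
  by have := IHk kn'; rewrite addKn; apply.
by rewrite cycleE /= addnS eqxx.
Qed.

Lemma cycle_walk_gap i j : walk G (gap i j) i j.
Proof.
rewrite /gap; case: (leqP i j) => ij.
  by rewrite (_ : i - j = 0)%N ?add0n; [exact: cycle_walk_up|lia].
apply: walk_sym; rewrite (_ : j - i = 0)%N ?addn0; [apply: cycle_walk_up; lia|lia].
Qed.

Lemma cycle_walk_around (u i : 'I_n) : u = 0%N :> nat -> walk G (n - i) u i.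
Proof.
move=> u0; have mn : (n.-1 < n)%N by lia.
have -> : (n - i = 1 + (Ordinal mn - i))%N by have := ltn_ord i; rewrite /=; lia.
apply: (walk_cat (y := Ordinal mn)); first by apply: walk1; rewrite cycleE u0 /=; lia.
by apply: walk_sym; apply: cycle_walk_up; have := ltn_ord i; rewrite /=; lia.
Qed.

(** The quantity [minn i (n - i)] is the distance from node 0 on the cycle; it serves as a potential
    in [path_lipschitz]. *)
Lemma circular_distance_lipschitz i j : G i j ->
  (minn i (n - i) <= (minn j (n - j)).+1)%N &&
  (minn j (n - j) <= (minn i (n - i)).+1)%N.
Proof. by rewrite cycleE; have := ltn_ord i; have := ltn_ord j; lia. Qed.

End Cycle.

(** * The antipodal chord *)

(** Here [A] counts nodes that send to [w] through [u], and [B] counts far pairs. After [2 P] is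
    bounded below by [1 - r (m - 3)], the terms in [r m^2] cancel, and [r (m - 5) <= 1] bounds what
    remains by a constant. *)
Lemma chord_traffic_ge (R : realType) (m A B P r : R) :
  20 <= m -> m <= 2 * A + 16 -> m * (m - 2) <= 4 * B + 32 * m ->
  0 <= P -> 0 <= r -> r * (m - 5) <= 1 -> 1 <= 2 * P + r * (m - 3) ->
  m / 4 - 24 <= A * P + r * B.
Proof.
move=> m20 mA mB P0 r0 rm Pr.
have r15 : r <= 15^-1 by move: rm r0 m20; nra.
have AP : (m - 16) / 2 * P <= A * P by rewrite ler_wpM2r //; lra.
have mP : (m - 16) / 4 * (1 - r * (m - 3)) <= (m - 16) / 2 * P.
  rewrite -subr_ge0 [leRHS](_ : _ = (m - 16) / 4 * (2 * P + r * (m - 3) - 1)); last by field.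
  by rewrite mulr_ge0; lra.
have rB : r * (m * (m - 34)) <= r * (4 * B) by rewrite ler_wpM2l //; lra.
move: rm r15 AP mP rB; lra.
Qed.

Section ChordDeviation.
Context (R : realType) (s : R) (n : nat) (u w : 'I_n).
Hypotheses (s_ge0 : 0 <= s) (n_ge20 : (20 <= n)%N).
Hypotheses (u0 : u = 0%N :> nat) (wE : w = n./2 :> nat).
Notation G := (cycle_network n).

Let n_ge3 : (2 < n)%N. Proof. by lia. Qed.

Let neq_uw : u != w.
Proof. by rewrite -val_eqE /= u0 wE; lia. Qed.

Let not_channel_uw : ~~ G u w.
Proof. by rewrite cycleE // u0 wE; lia. Qed.

Notation H := (add_channel G neq_uw).

Let neq_u i : (i != u) = (0 < i)%N.
Proof. by rewrite -val_eqE /= u0 lt0n. Qed.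

Let cycle_walk_to_u (i : 'I_n) : walk G i u i.
Proof. by have := @cycle_walk_up n n_ge3 u i; rewrite u0 subn0; apply. Qed.

Lemma not_channel_gap (x y : 'I_n) : x != u -> y != u -> (1 < gap x y)%N -> ~~ G x y.
Proof. by rewrite !neq_u cycleE // /gap => x0 y0 xy; lia. Qed.

(** Split at [u], the path is at least as long as the circular distances of [x] and [y] from 0
    together. That sum is [x + y], [2 n - x - y] or [n - |x - y|], or larger than [|x - y|] for the
    same reasons. *)
Lemma gap_via_cycle (x y : 'I_n) p : x != u -> y != u -> (2 * gap x y < n)%N ->
  path_between G x y p -> u \in p -> (gap x y < size p)%N.
Proof.
rewrite !neq_u => x0 y0 xyn /andP[] /[swap] + + up.
case/path.splitP: up => p1 p2; rewrite cat_path last_cat last_rcons.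
move=> /eqP p2y /andP[xp1 up2].
have lip := circular_distance_lipschitz n_ge3.
have := path_lipschitz lip xp1; have := path_lipschitz lip up2.
rewrite last_rcons p2y u0 size_cat size_rcons.
rewrite !min0n => /andP[_ yp2] /andP[xp1' _].
move: x0 y0 xyn (ltn_ord x) (ltn_ord y) yp2 xp1'; rewrite /gap.
by move: (size p1) (size p2) => j k; lia.
Qed.

(** Avoiding [u] rules out both the chord and the edge between 0 and [n - 1], so every step changes
    the index by 1. *)
Lemma gap_avoiding_chord (x y : 'I_n) p : x != u ->
  path_between H x y p -> u \notin p -> (gap x y <= size p)%N.
Proof.
move=> xu /andP[xp /eqP py] up.
have lip (i j : 'I_n) : (i == j.+1 :> nat) || (j == i.+1 :> nat) ->
  (i <= j.+1)%N && (j <= i.+1)%N by lia.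
have {}xp : path (fun i j : 'I_n => (i == j.+1 :> nat) || (j == i.+1 :> nat)) x p.
  apply: (sub_in_path (P := predC1 u)) xp => [i j|].
    rewrite !inE => iu ju; rewrite (@add_channel_deviation _ G _ _ neq_uw) // cycleE //.
    by move: iu ju; rewrite !neq_u; lia.
  by rewrite /= xu; apply/allP => i ip /=; apply: contraNneq up => <-.
have := path_lipschitz lip xp; rewrite py /gap.
by move: (size p) => k; lia.
Qed.

(** Without [x], its two neighbours have degree 1 and the other [n - 3] nodes tie at degree 2. *)
Lemma ptrans_cycle_le (x y : 'I_n) : y != x -> ~~ G x y ->
  ptrans G s x y <= (n - 3)%:R^-1.
Proof.
move=> yx xy; apply: le_trans (ptrans_le_num_same_degree G s yx) _.
have -> // : num_same_degree G x y = (n - 3)%N.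
rewrite /num_same_degree (_ : [set _ | _] = ~: (x |: [set z | G x z])).
  have := cardsC (x |: [set z | G x z]); rewrite cardsU1 inE channel_irr.
  by rewrite -/(degree G x) degree_cycle // card_ord; move: #|~: _| => k; lia.
apply/setP => z; rewrite !inE negb_or !degree_del_cycle // (negPf xy).
by case: (G x z) => //; rewrite andbF.
Qed.

Lemma revenue_cycle_le (b : R) : 0 <= b ->
  revenue G s b u <= b * ((n./2 * n./2.+1)%:R / (n - 3)%:R).
Proof.
move=> b0; apply: ler_wpM2l => //.
(* The least [h] with [2 h >= n] is [uphalf n]; pairs at a smaller gap bring [u] nothing, and
   [sum_gap_ge2] counts the others. *)
have -> : (n./2 = n - uphalf n)%N by lia.
rewrite -sum_gap_ge2; last by lia.
rewrite natr_sum mulr_suml big_mkcond; apply: ler_sum => x _.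
rewrite natr_sum mulr_suml; case: ifPn => [xu|_]; last first.
  by apply: sumr_ge0 => y _; rewrite divr_ge0.
rewrite big_mkcond; apply: ler_sum => y _.
case: ifPn => [/andP[yu yx]|_]; last by rewrite divr_ge0.
case: leqP => xyn; last first.
  rewrite (num_shortest_via_eq0 yu (cycle_walk_gap n_ge3 x y)) ?mul0r // => p.
  by apply: gap_via_cycle => //; lia.
rewrite ler_pM ?ptrans_ge0 ?divr_ge0 //.
  exact: num_shortest_ratio_le1.
apply: ptrans_cycle_le => //; apply: not_channel_gap => //.
by apply: leq_trans xyn; lia.
Qed.

(** * Revenue of [u] with the chord *)

(** Deleting such a node leaves [u] and [w] with degree 3, as [ptrans_three_classes] demands. *)
Definition generic : {set 'I_n} := ~: ([set u; w] :|: [set v | G u v] :|: [set v | G w v]).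

Lemma card_not_generic : (#|~: generic| <= 6)%N.
Proof.
rewrite setCK; apply: leq_trans (leq_card_setU _ _) _.
apply: leq_trans (leq_add (leq_card_setU _ _) (leqnn _)) _.
by rewrite -/(degree G w) -/(degree G u) !degree_cycle // cards2 neq_uw.
Qed.

(** The probabilities [2 P], [(n - 5) r] and those of the two neighbours of [x] sum to 1. The
    neighbours rank last, so each has between 0 and [r], which yields both bounds. *)
Lemma ptrans_chord : exists P r : R,
  [/\ 0 <= P, 0 <= r, r * (n - 5)%:R <= 1, 1 <= 2 * P + r * (n - 3)%:R &
    forall x, x \in generic -> ptrans H s x w = P /\
      forall y, y != x -> y \notin [set u; w] -> ~~ G x y -> ptrans H s x y = r].
Proof.
pose FA := average_rank_weight s 1 2; pose FB := average_rank_weight s (n - 2) 2.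
pose FC := average_rank_weight s 3 (n - 5).
pose Z := 2 * FA + (n - 5)%:R * FC + 2 * FB.
have FA0 : 0 < FA by apply: average_rank_weight_gt0.
have FB0 : 0 < FB by apply: average_rank_weight_gt0; lia.
have FC0 : 0 < FC by apply: average_rank_weight_gt0; lia.
have FBC : FB <= FC.
  apply: le_trans (average_rank_weight_le _ _ s_ge0) _; [lia|by []|].
  rewrite (_ : n - 2 = 3 + (n - 5))%N; last by lia.
  by apply: average_rank_weight_ge; lia.
have Z0 : 0 < Z.
  have : 0 <= (n - 5)%:R * FC by rewrite mulr_ge0 // ltW.
  by rewrite /Z; move: FA0 FB0; lra.
have n53 : (n - 3)%:R = (n - 5)%:R + 2 :> R by rewrite -natrD; congr _%:R; lia.
exists (FA / Z), (FC / Z); split.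
- by rewrite divr_ge0 ?ltW.
- by rewrite divr_ge0 ?ltW.
- by rewrite mulrAC ler_pdivrMr // mul1r /Z; move: FA0 FB0; lra.
- rewrite mulrA [FC / Z * _]mulrAC -mulrDl ler_pdivlMr // mul1r n53 /Z.
  by move: FBC; lra.
move=> x; rewrite !inE !negb_or -!andbA => /and4P[xu xw ux wx].
have key := @ptrans_three_classes R _ H s x [set u; w] [set v | G x v].
have {}key v : v != x -> ptrans H s x v =
  (if v \in [set u; w] then FA else if v \in [set v | G x v] then FB else FC) / Z.
  move=> vx; rewrite key ?card_ord //.
  - by rewrite !inE negb_or xu.
  - by rewrite inE channel_irr.
  - rewrite disjoints_subset; apply/subsetP => y; rewrite !inE channel_sym.
    by case/orP => /eqP ->.
  - by rewrite cards2 neq_uw.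
  - by rewrite -/(degree G x) degree_cycle.
  - exact: leq_trans n_ge20.
  move=> y yx; have := degree_delE H x y; rewrite degree_add_channel //.
  by rewrite add_channel_old // degree_cycle // [in G y x]channel_sym !inE.
split; first by rewrite key ?inE ?eqxx ?orbT // eq_sym.
by move=> y yx yA Gxy; rewrite key // (negPf yA) inE (negPf Gxy).
Qed.

(** By [gap_avoiding_chord], a walk shorter than the gap beats every path that avoids [u]. *)
Lemma num_shortest_ratio_eq1 k (x y : 'I_n) : x != u -> y != u ->
  walk H k x y -> (k < gap x y)%N ->
  (num_shortest_via H u x y)%:R / (num_shortest H x y)%:R = 1 :> R.
Proof.
move=> xu yu kxy kgap.
have [|-> ?] := num_shortest_via_all yu kxy; last by rewrite divff // pnatr_eq0 -lt0n.
by move=> p xp up; apply: leq_trans (gap_avoiding_chord xu xp up).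
Qed.

Let walkH k x y : walk G k x y -> walk H k x y.
Proof. exact/walk_mono/add_channel_sub. Qed.

Lemma num_shortest_ratio_far (x y : 'I_n) : x != u -> y != u ->
  (n./2 < gap x y)%N ->
  (num_shortest_via H u x y)%:R / (num_shortest H x y)%:R = 1 :> R.
Proof.
move=> xu yu far.
case: (leqP x y) => xy.
  apply: (@num_shortest_ratio_eq1 (x + (n - y))) => //.
    apply: (walk_cat (y := u)); apply: walkH; first exact/walk_sym/cycle_walk_to_u.
    exact: cycle_walk_around.
  by move: far (ltn_ord y); rewrite /gap; lia.
apply: (@num_shortest_ratio_eq1 ((n - x) + y)) => //.
  apply: (walk_cat (y := u)); apply: walkH; last exact/cycle_walk_to_u.
  exact/walk_sym/cycle_walk_around.
by move: far (ltn_ord x); rewrite /gap; lia.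
Qed.

(** With [h = n./2], the rounded thresholds say exactly [x + 1 < h - x] and [(n - x) + 1 < x - h]:
    going to [u] and over the chord is strictly shorter than the arc to [w] that avoids [u]. *)
Definition via_chord (x : nat) : bool := (x < n./2./2)%N || ((n + n./2 + 1)./2 < x)%N.

Lemma num_shortest_ratio_chord (x : 'I_n) : x != u -> via_chord x ->
  (num_shortest_via H u x w)%:R / (num_shortest H x w)%:R = 1 :> R.
Proof.
move=> xu; have uw := walk1 (add_channel_new G neq_uw).
have wu : w != u by rewrite eq_sym.
case/orP => hx.
  apply: (@num_shortest_ratio_eq1 (x + 1)) => //.
    by apply: (walk_cat _ uw); apply: walkH; exact/walk_sym/cycle_walk_to_u.
  by rewrite /gap wE; lia.
apply: (@num_shortest_ratio_eq1 ((n - x) + 1)) => //.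
  by apply: (walk_cat _ uw); apply: walkH; exact/walk_sym/cycle_walk_around.
by move: (ltn_ord x); rewrite /gap wE; lia.
Qed.

(** At least [n / 2 - 2] nodes satisfy [via_chord], and at most 6 of them are not generic; doubling
    gives 4 + 12 = 16. *)
Lemma card_via_chord_ge :
  (n <= 2 * (\sum_(x in generic) via_chord x) + 16)%N.
Proof.
set alpha := bigop _ _ _.
have : (\sum_(x < n) via_chord x <= alpha + 6)%N.
  rewrite (bigID [in generic]) /= leq_add2l; apply: leq_trans card_not_generic.
  rewrite -sum1_card [leqRHS](eq_bigl [predC generic]) => [|x]; last by rewrite !inE.
  by apply: leq_sum => x _; case: via_chord.
have -> : (\sum_(x < n) via_chord x =
    \sum_(x < n) ((x < n./2./2) + ((n + n./2 + 1)./2.+1 <= x)))%N.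
  by apply: eq_bigr => x _; rewrite /via_chord; lia.
rewrite -(big_mkord xpredT (fun x => (x < n./2./2) + ((n + n./2 + 1)./2.+1 <= x))%N).
by rewrite sum_lt_ge; lia.
Qed.

(** Leaving out [y = u] and [y = w] costs at most [2 n] pairs, and leaving out the non-generic [x]
    at most [6 n]; four times their sum is [32 n]. *)
Lemma card_far_pairs_ge :
  (n * (n - 2) <= 4 * (\sum_(x in generic) \sum_(y | y \notin [set u; w])
                         (n./2.+1 <= gap x y)) + 32 * n)%N.
Proof.
set beta := bigop _ _ _.
have : (\sum_(x < n) \sum_(y < n) (n./2.+1 <= gap x y) <= beta + n * 2 + 6 * n)%N.
  rewrite (bigID [in generic]) /=; apply: leq_add.
    apply: (@leq_trans (beta + \sum_(x in generic) 2)); last first.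
      rewrite leq_add2l sum_nat_const leq_mul2r.
      by apply: leq_trans (max_card _) _; rewrite card_ord.
    rewrite /beta -big_split; apply: leq_sum => x _.
    rewrite (bigID (fun y => y \notin [set u; w])) /= leq_add2l.
    apply: (@leq_trans (\sum_(y in [set u; w]) 1)).
      rewrite [leqRHS](eq_bigl (fun y => ~~ (y \notin [set u; w]))).
        by apply: leq_sum => y _; exact: leq_b1.
      by move=> y; rewrite negbK.
    by rewrite sum1_card cards2 neq_uw.
  apply: (@leq_trans (\sum_(x | x \notin generic) n)).
    apply: leq_sum => x _; rewrite -[leqRHS]card_ord -sum1_card.
    by apply: leq_sum => y _; exact: leq_b1.
  rewrite sum_nat_const leq_mul2r; apply/orP; right.
  apply: leq_trans card_not_generic; apply: subset_leq_card.
  by apply/subsetP => x; rewrite in_setC.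
rewrite sum_gap_ge2 //; move: beta => {}beta.
have [q [-> nq]] : exists q, (n - n./2.+1 = q /\ (n = 2 * q + 2 \/ n = 2 * q + 1))%N.
  by exists (n - n./2.+1)%N; lia.
by case: nq => ->; nia.
Qed.

Lemma revenue_chord_ge (b : R) : 0 <= b -> b * (n%:R / 4 - 24) <= revenue H s b u.
Proof.
move=> b0; apply: ler_wpM2l => //.
have [P [r [P0 r0 rn Pr PrE]]] := ptrans_chord.
pose alpha := (\sum_(x in generic) via_chord x)%N.
pose beta := (\sum_(x in generic) \sum_(y | y \notin [set u; w]) (n./2.+1 <= gap x y))%N.
have alphaE : (n <= 2 * alpha + 16)%N := card_via_chord_ge.
have betaE : (n * (n - 2) <= 4 * beta + 32 * n)%N := card_far_pairs_ge.
(* For each generic [x], only [y = w] under [via_chord x] and the far [y] outside [[set u; w]] are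
   kept; the dropped terms are nonnegative. *)
have step : alpha%:R * P + r * beta%:R <= \sum_(x | x != u) \sum_(y | (y != u) && (y != x))
    (num_shortest_via H u x y)%:R / (num_shortest H x y)%:R * ptrans H s x y.
  have term_ge0 x y : y != x -> 0 <=
      (num_shortest_via H u x y)%:R / (num_shortest H x y)%:R * ptrans H s x y.
    by move=> yx; rewrite mulr_ge0 ?ptrans_ge0 // divr_ge0.
  rewrite !natr_sum mulr_suml mulr_sumr -big_split /=.
  rewrite big_mkcond [leRHS]big_mkcond; apply: ler_sum => x _.
  case: ifPn => [xgen|_]; last first.
    by case: ifPn => // _; apply: sumr_ge0 => y /andP[_]; exact: term_ge0.
  have [xu xw] : x != u /\ x != w.
    by move: xgen; rewrite !inE !negb_or -!andbA => /and4P[].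
  have [PrW PrY] := PrE x xgen.
  have wux : (w != u) && (w != x) by rewrite eq_sym neq_uw eq_sym.
  rewrite xu [leRHS](bigD1 w) //=; apply: lerD.
    case via: (via_chord x); last by rewrite mul0r term_ge0 // eq_sym.
    by rewrite num_shortest_ratio_chord // PrW.
  rewrite natr_sum mulr_sumr big_mkcond [leRHS]big_mkcond; apply: ler_sum => y _.
  rewrite !inE negb_or; case: (eqVneq y u) => //= yu.
  case: (eqVneq y w) => [|yw] /=; first by rewrite andbF.
  rewrite andbT; case: (eqVneq y x) => [->|yx] /=; first by rewrite /gap subnn mulr0.
  case: ltnP => far; last by rewrite mulr0 term_ge0.
  rewrite mulr1 num_shortest_ratio_far // mul1r PrY //.
    by rewrite !inE negb_or yu.
  by rewrite not_channel_gap // (leq_trans _ far) // ltnS half_gt0 (leq_trans _ n_ge20).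
apply: le_trans step.
have n_ge m : (m <= 20)%N -> (m <= n)%N by move=> h; apply: leq_trans h n_ge20.
have nR m : (m <= 20)%N -> (n - m)%:R = n%:R - m%:R :> R by move=> h; rewrite natrB ?n_ge.
have n20 : 20 <= n%:R :> R by rewrite ler_nat.
have aR : n%:R <= 2 * alpha%:R + 16 :> R by rewrite -!natrM -!natrD ler_nat.
have bR : n%:R * (n%:R - 2) <= 4 * beta%:R + 32 * n%:R :> R.
  by rewrite -nR // -!natrM -!natrD ler_nat.
by rewrite nR // in rn; rewrite nR // in Pr; exact: chord_traffic_ge n20 aR bR P0 r0 rn Pr.
Qed.

(** * Savings in fees and conclusion *)

(** Such a [v] has the top degree once [u] is deleted, so its probability is at least the
    average. *)
Lemma ptrans_cycle_ge (v : 'I_n) : v != u -> ~~ G u v -> n%:R^-1 <= ptrans G s u v.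
Proof.
move=> vu uv; rewrite -[leLHS]mul1r ler_pdivrMr ?ltr0n ?(leq_trans _ n_ge20) //.
rewrite mulr_natr; have <- : \sum_(y < n) ptrans G s u v = ptrans G s u v *+ n.
  by rewrite sumr_const card_ord.
rewrite -(ptrans_sum G s vu) big_mkcond.
apply: ler_sum => y _; case: ifPn => [yu|_]; last exact: ptrans_ge0.
by apply: ptrans_mono => //; rewrite !degree_del_cycle // (negPf uv) leq_subr.
Qed.

Lemma dist_cycle_ge (v : 'I_n) d : walk G d u v -> (minn v (n - v) <= d)%N.
Proof.
move=> [p /andP[up /eqP pv] <-].
have lip := circular_distance_lipschitz n_ge3.
by have /andP[_] := path_lipschitz lip up; rewrite pv u0 min0n.
Qed.

Lemma dist_chord_le v : fine (dist H u v) <= fine (dist G u v) :> R.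
Proof.
have [d [-> dG _]] := dist_walk R (cycle_walk_to_u v).
have [d' [-> _ d'min]] := dist_walk R (walkH dG).
by rewrite ler_nat; apply: d'min (walkH dG).
Qed.

(** These nodes are at distance about [3 n / 8] or more on the cycle, but at most [n / 8 + 1] over
    the chord. *)
Lemma dist_chord_near (v : 'I_n) : (n./2 <= v < n./2 + (n %/ 8).+1)%N ->
  n%:R / 8 <= fine (dist G u v) - fine (dist H u v) :> R.
Proof.
move=> near; have [d [-> /dist_cycle_ge dG _]] := dist_walk R (cycle_walk_to_u v).
have uwv : walk H (1 + (v - w)) u v.
  apply: (walk_cat (walk1 (add_channel_new G neq_uw))).
  by apply: walkH; apply: cycle_walk_up; rewrite // wE; case/andP: near.
have [d' [-> _ /(_ _ uwv) d'min]] := dist_walk R uwv.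
have : (n + 8 * d' <= 8 * d)%N by move: d'min; rewrite wE; lia.
by rewrite -(ler_nat R) natrD !natrM /=; lra.
Qed.

(** At least [n / 8] nodes come closer by [n / 8] or more, each with probability at least [1 / n];
    no other node moves away. *)
Lemma fees_chord_gain :
  n%:R / 64 <= \sum_(v | v != u) fine (dist G u v) * ptrans G s u v -
               \sum_(v | v != u) fine (dist H u v) * ptrans H s u v.
Proof.
have n0 : 0 < n%:R :> R by rewrite ltr0n (leq_trans _ n_ge20).
pose near v := (n./2 <= v < n./2 + (n %/ 8).+1)%N.
have cnt : n%:R / 8 <= (\sum_(v < n) near v)%N%:R :> R.
  rewrite -(big_mkord xpredT (fun v => near v : nat)) sum_interval.
  by rewrite ler_pdivrMr // -natrM ler_nat; lia.
rewrite -sumrB [leRHS]big_mkcond /=.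
apply: (@le_trans _ _ (\sum_(v < n) (near v)%:R / 8)).
  by rewrite -mulr_suml -natr_sum; move: cnt; lra.
apply: ler_sum => v _; case: (eqVneq v u) => [->|vu].
  rewrite /near u0 [(_ <= 0)%N](_ : _ = false) ?mul0r //=.
  by apply/negbTE; rewrite -ltnNge half_gt0 (leq_trans _ n_ge20).
rewrite (ptrans_deviation _ (add_channel_deviation _ neq_uw)) // -mulrBl.
case nv: (near v); last first.
  by rewrite mul0r mulr_ge0 ?ptrans_ge0 // subr_ge0 dist_chord_le.
have nGuv : ~~ G u v.
  by rewrite cycleE // u0; move: nv; rewrite /near; have := ltn_ord v; lia.
apply: (@le_trans _ _ (n%:R / 8 * n%:R^-1)).
  by rewrite mulrAC divff ?gt_eqF.
apply: ler_pM => //; first exact: dist_chord_near.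
exact: ptrans_cycle_ge.
Qed.

(** Revenue falls from at most [b (n / 4 + 3)] to at least [b (n / 4 - 24)], a loss of at most
    [27 b]. Together with the channel cost [l] this is less than the savings [a n / 64]. *)
Lemma cycle_chord_not_nash (a b l : R) : 0 < a -> 0 < b ->
  64 * (27 * b + l) / a < n%:R -> ~ nash_equilibrium s a b l G.
Proof.
move=> a0 b0 big_n /(_ u H (add_channel_deviation _ neq_uw)); apply.
have conn v : exists k, walk G k u v by exists v; exact: cycle_walk_to_u.
have connH v : exists k, walk H k u v by exists v; exact: walkH.
rewrite /utility !fees_connected // -!EFinB lte_fin /channel_cost.
rewrite degree_add_channel // degree_cycle // !inE eqxx /=.
have := revenue_cycle_le (ltW b0); have := revenue_chord_ge (ltW b0).
have := fees_chord_gain.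
move: (\sum_(v | _) _) (\sum_(v | _) _) => FG FH gain.
move: (revenue _ _ _ _) (revenue _ _ _ _) => rH rG rHge.
rewrite ltr_pdivrMr // in big_n.
have old : (n./2 * n./2.+1)%:R / (n - 3)%:R <= n%:R / 4 + 3 :> R.
  have n20 : 20 <= n%:R :> R by rewrite ler_nat.
  have n3 : (3 < n)%N by apply: leq_trans n_ge20.
  rewrite ler_pdivrMr ?ltr0n ?subn_gt0 // natrB 1?ltnW //.
  suff : 4 * (n./2 * n./2.+1)%:R <= n%:R * (n%:R + 2) :> R by move: n20; lra.
  rewrite -natrD -!natrM ler_nat.
  have : (2 * n./2 <= n)%N by rewrite mul2n -[leqRHS]odd_double_half leq_addl.
  nia.
rewrite natrD => rGle.
move: (ler_wpM2l (ltW b0) old) (ler_wpM2l (ltW a0) gain) => {}old {}gain.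
move: (le_trans rGle old); lra.
Qed.

End ChordDeviation.

Theorem theorem11 (R : realType) (s a b l : R) :
  0 <= s -> 0 < a -> 0 < b -> 0 < l ->
  exists n0 : nat, forall n : nat, (n0 <= n)%N ->
    ~ nash_equilibrium s a b l (cycle_network n).
Proof.
move=> s0 a0 b0 l0; pose c := 64 * (27 * b + l) / a.
have c0 : 0 <= c.
  by rewrite divr_ge0 ?(ltW a0) // mulr_ge0 // addr_ge0 ?(ltW l0) // mulr_ge0 // ltW.
(* The 20 serves the chord estimates; the Archimedean bound puts [n] above [c], where the saved fees
   exceed [27 b + l]. *)
exists (maxn 20 (Num.bound c)) => n; rewrite geq_max => /andP[n20 cn].
have u_lt : (0 < n)%N by exact: leq_trans n20.
have w_lt : (n./2 < n)%N by lia.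
apply: (@cycle_chord_not_nash R s n (Ordinal u_lt) (Ordinal w_lt)) => //.
by apply: lt_le_trans (archi_boundP c0) _; rewrite ler_nat.
Qed.
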